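(* Let $\Bbbk$ be an algebraically closed field of characteristic zero and let $\mathcal{V}$ be the Virasoro algebra over $\Bbbk$. Let $M$ be a simple weight $\mathcal{V}$-module. Assume that there exists $\lambda\in\Bbbk$ such that $\dim M_{\lambda}=\infty$. Then $\mathrm{supp}(M)=\lambda+\mathbb{Z}$ and for every $k\in\mathbb{Z}$ we have $\dim M_{\lambda+k}=\infty$.
   Context: The Virasoro algebra $\mathcal{V}$ over $\Bbbk$ has basis consisting of a central element $c$ and elements $e_i$, $i\in\mathbb{Z}$, with bracket $[e_i,e_j]=(j-i)e_{i+j}+\delta_{i,-j}\frac{i^3-i}{12}c$. Its Cartan subalgebra is the span of $c$ and $e_0$. A weight $\mathcal{V}$-module is a module on which $e_0$ and $c$ act diagonalizably; for $\lambda\in\Bbbk$, $M_\lambda=\{m\in M: e_0m=\lambda m\}$ is the weight space, and $M=\bigoplus_{\lambda\in\Bbbk}M_\lambda$. The support $\mathrm{supp}(M)$ is the set of $\lambda\in\Bbbk$ with $M_\lambda\neq 0$. *)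

(* Defs.v *)
From HB Require Import structures.
From mathcomp Require Import all_boot all_order all_algebra.
Set Implicit Arguments. Unset Strict Implicit. Unset Printing Implicit Defensive.
Import Order.TTheory GRing.Theory Num.Theory.
Local Open Scope ring_scope.

(* A representation of the Virasoro algebra on the k-vector space M:
   e i : M -> M is the action of e_i (i : int), c : M -> M is the action of
   the central element c.  The bracket is
   [e_i, e_j] = (j - i) e_{i+j} + delta_{i,-j} (i^3 - i)/12 c,  [c, _] = 0. *)
Definition is_vir_module (k : fieldType) (M : lmodType k)
    (e : int -> M -> M) (c : M -> M) : Prop :=
  [/\ (forall i (a : k) (u v : M), e i (a *: u + v) = a *: e i u + e i v),
      (forall (a : k) (u v : M), c (a *: u + v) = a *: c u + c v),
      (forall i (m : M), c (e i m) = e i (c m)) &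
      (forall i j (m : M),
         e i (e j m) - e j (e i m) =
         ((j - i)%:~R : k) *: e (i + j) m
         + (if i == - j then (((i ^+ 3 - i)%:~R : k) / 12%:R) *: c m else 0))].

Definition weight_space (k : fieldType) (M : lmodType k) (f : M -> M)
    (lam : k) : M -> Prop := fun m => f m = lam *: m.

Definition diagonalizable (k : fieldType) (M : lmodType k) (f : M -> M) : Prop :=
  forall m : M, exists s : seq (k * M),
    (forall p, p \in s -> f p.2 = p.1 *: p.2) /\ m = \sum_(p <- s) p.2.

Definition is_weight_module (k : fieldType) (M : lmodType k)
    (e : int -> M -> M) (c : M -> M) : Prop :=
  diagonalizable (e 0) /\ diagonalizable c.

Definition is_submodule (k : fieldType) (M : lmodType k)
    (e : int -> M -> M) (c : M -> M) (N : M -> Prop) : Prop :=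
  [/\ N 0,
      (forall (a : k) u v, N u -> N v -> N (a *: u + v)),
      (forall i u, N u -> N (e i u)) &
      (forall u, N u -> N (c u))].

Definition is_simple (k : fieldType) (M : lmodType k)
    (e : int -> M -> M) (c : M -> M) : Prop :=
  (exists m : M, m != 0) /\
  forall N : M -> Prop, is_submodule e c N ->
    (forall m, N m -> m = 0) \/ (forall m, N m).

Definition lin_indep (k : fieldType) (M : lmodType k) (s : seq M) : Prop :=
  forall a : seq k, size a = size s ->
    \sum_(i < size s) a`_i *: s`_i = 0 -> forall i, a`_i = 0.

Definition infinite_dim (k : fieldType) (M : lmodType k) (P : M -> Prop) : Prop :=
  forall n : nat, exists s : seq M,
    size s = n /\ (forall m, m \in s -> P m) /\ lin_indep s.

Definition in_support (k : fieldType) (M : lmodType k) (e : int -> M -> M)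
    (lam : k) : Prop :=
  exists m : M, m != 0 /\ weight_space (e 0) lam m.

(* Main.v *)
(* Suppose dim M_mu is finite while dim M_(mu-1) is infinite.  Any finite set
   of elements of degree 1 in the enveloping algebra has an infinite-dimensional
   common kernel on M_(mu-1), so one finds a != 0 there killed by e_1,
   e_{-1} e_2 and a few more.  For b = e_2 a this forces e_2 b to be a multiple
   of e_1^2 b, unless mu = 1 or mu = -3/2, since the difference generates
   lowest weight vectors and these do not exist in a simple module with an
   infinite-dimensional weight space.  The relation 6 [e_2, e_3] = ad(e_1)^3 e_2
   then gives mu in {0, 1}.  Combining this with its image under the involution
   e_i |-> - e_{-i} leaves only mu = 0.  There the same relations force c = 0 and
   make a and b generate a copy of k[t, 1/t] / k under e_m = t^(m+1) d/dt, so M has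
   one-dimensional weight spaces, a contradiction. *)

Require Import Defs.
From HB Require Import structures.
From mathcomp Require Import all_boot all_order all_algebra.
From mathcomp Require Import ring zify.
From Stdlib Require Import Classical.
Import Order.TTheory GRing.Theory Num.Theory.
Local Open Scope ring_scope.
Set Implicit Arguments. Unset Strict Implicit. Unset Printing Implicit Defensive.

(** * Finite spans, kernels and infinite-dimensional subspaces *)

Section LinearAlgebra.
Context {k : fieldType} {M : lmodType k}.

Definition lin (f : M -> M) : Prop :=
  forall (a : k) u v, f (a *: u + v) = a *: f u + f v.

Definition subspace (P : M -> Prop) : Prop :=
  P 0 /\ forall (a : k) u v, P u -> P v -> P (a *: u + v).

Definition in_span (s : seq M) (m : M) : Prop :=
  exists a : nat -> k, m = \sum_(i < size s) a i *: s`_i.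

Lemma lin0 f : lin f -> f 0 = 0.
Proof. by move=> hf; have := hf (-1) 0 0; rewrite scaler0 addr0 scaleN1r addNr. Qed.

Lemma linD f u v : lin f -> f (u + v) = f u + f v.
Proof. by move=> hf; rewrite -[u]scale1r hf !scale1r. Qed.

Lemma linZ f a u : lin f -> f (a *: u) = a *: f u.
Proof. by move=> hf; rewrite -[a *: u]addr0 hf (lin0 hf) addr0. Qed.

Lemma linN f u : lin f -> f (- u) = - f u.
Proof. by move=> hf; rewrite -scaleN1r linZ // scaleN1r. Qed.

Lemma lin_sum f (I : Type) (r : seq I) (P : pred I) (F : I -> M) :
  lin f -> f (\sum_(i <- r | P i) F i) = \sum_(i <- r | P i) f (F i).
Proof.
move=> hf; elim/big_rec2: _ => [|i u v _ <-]; first exact: lin0.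
by rewrite linD.
Qed.

Lemma lin_comp f g : lin f -> lin g -> lin (fun x => f (g x)).
Proof. by move=> hf hg a u v; rewrite hg hf. Qed.

Lemma lin_lincomb f g b : lin f -> lin g -> lin (fun x => f x + b *: g x).
Proof.
move=> hf hg a u v; rewrite hf hg !scalerDr !scalerA mulrC !addrA.
by congr (_ + _); rewrite -!addrA; congr (_ + _); rewrite addrC.
Qed.

Lemma lin_id : lin id.
Proof. by []. Qed.

Lemma in_span0 s : in_span s 0.
Proof. by exists (fun=> 0); rewrite big1 // => i _; rewrite scale0r. Qed.

Lemma in_span_lin s (a : k) u v :
  in_span s u -> in_span s v -> in_span s (a *: u + v).
Proof.
move=> [x ->] [y ->]; exists (fun i => a * x i + y i).
rewrite scaler_sumr -big_split; apply: eq_bigr => i _ /=.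
by rewrite scalerA scalerDl.
Qed.

Lemma in_span_mem (s : seq M) x : x \in s -> in_span s x.
Proof.
move=> xs; have hi : (index x s < size s)%N by rewrite index_mem.
exists (fun i => (i == index x s)%:R).
rewrite (bigD1 (Ordinal hi)) //= eqxx scale1r nth_index // big1 ?addr0 // => i.
by rewrite -val_eqE /= => /negPf ->; rewrite scale0r.
Qed.

Lemma infinite_dim_sub (P Q : M -> Prop) :
  (forall m, P m -> Q m) -> infinite_dim P -> infinite_dim Q.
Proof.
move=> PQ hP n; have [s [sn [hs ls]]] := hP n.
by exists s; split => //; split => // m /hs /PQ.
Qed.

(** Rank-nullity: the images of [n + d] independent vectors lie in the span of [d] vectors, so their
    coefficient matrix has a left kernel of rank at least [n]. Independent rows of that kernel give
    the required vectors. *)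
Lemma infinite_dim_ker_span (P : M -> Prop) (f : M -> M) (t : seq M) :
  subspace P -> lin f -> (forall x, P x -> in_span t (f x)) ->
  infinite_dim P -> infinite_dim (fun x => P x /\ f x = 0).
Proof.
move=> [P0 PD] hf ft hP n; set d := size t.
have [s [sN [hs ls]]] := hP (n + d)%N.
have /fin_all_exists [a ha] (i : 'I_(n + d)) : exists a : nat -> k,
    f s`_i = \sum_(j < d) a j *: t`_j.
  by apply/ft/hs/mem_nth; rewrite sN.
pose A := \matrix_(i < n + d, j < d) a i j.
pose K := row_base (kermx A).
have hr : (n <= \rank (kermx A))%N.
  by rewrite mxrank_ker; have := rank_leq_col A; lia.
pose B : 'M_(n, n + d) := pid_mx n *m K.
have KA : K *m A = 0.
  by apply/sub_kermxP; rewrite eq_row_base.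
have BA : B *m A = 0 by rewrite -mulmxA KA mulmx0.
have Bfree : row_free B.
  by rewrite /row_free mxrankMfree ?row_base_free // rank_pid_mx.
pose F (i : 'I_n) := \sum_(j < n + d) B i j *: s`_j.
exists [seq F i | i <- enum 'I_n]; split; first by rewrite size_map size_enum_ord.
split.
  move=> m /mapP [i _ ->]; split.
    rewrite /F; elim/big_ind: _ => // [u v Pu Pv|j _].
      by rewrite -[u]scale1r; apply: PD.
    by rewrite -[_ *: _]addr0; apply: PD => //; apply/hs/mem_nth; rewrite sN.
  rewrite /F lin_sum //.
  have -> : \sum_(j < n + d) f (B i j *: s`_j) =
            \sum_(l < d) (B *m A) i l *: t`_l.
    under [RHS]eq_bigr => l _ do rewrite mxE scaler_suml.
    rewrite exchange_big /=; apply: eq_bigr => j _.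
    rewrite linZ // ha scaler_sumr; apply: eq_bigr => l _.
    by rewrite scalerA [A _ _]mxE.
  by rewrite BA big1 // => l _; rewrite mxE scale0r.
move=> x; rewrite size_map size_enum_ord => sx hx.
pose u := \row_(i < n) x`_i.
(* A relation [u] among the vectors [F i] is the relation [u *m B] among the independent vectors of
   [s], and the rows of [B] are free. *)
have huB : \sum_(j < n + d) (u *m B) 0 j *: s`_j = 0.
  rewrite -[RHS]hx; under eq_bigr => j _ do rewrite mxE scaler_suml.
  rewrite exchange_big /=; apply: eq_bigr => i _.
  rewrite (nth_map i) ?size_enum_ord // nth_ord_enum /F scaler_sumr.
  by apply: eq_bigr => j _; rewrite scalerA [u _ _]mxE.
have uB0 : u *m B = 0.
  apply/rowP => j; rewrite [RHS]mxE.
  have := ls [seq (u *m B) 0 j | j <- enum 'I_(n + d)].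
  rewrite size_map size_enum_ord sN => /(_ erefl) H.
  have -> : (u *m B) 0 j = [seq (u *m B) 0 j | j <- enum 'I_(n + d)]`_j.
    by rewrite (nth_map j) ?size_enum_ord // nth_ord_enum.
  apply: H; rewrite -[RHS]huB; apply: eq_bigr => i _; congr (_ *: _).
  by rewrite (nth_map i) ?size_enum_ord // nth_ord_enum.
have u0 : u = 0 by apply: (row_free_inj Bfree); rewrite uB0 mul0mx.
move=> i; case: (ltnP i n) => [hi|hi]; last by rewrite nth_default ?sx.
by have /rowP/(_ (Ordinal hi)) := u0; rewrite !mxE.
Qed.

Lemma infinite_dim_neq0 (P : M -> Prop) :
  infinite_dim P -> exists m, m != 0 /\ P m.
Proof.
move=> /(_ 1%N) [[|m [|? s]] [//= _ [hs ls]]].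
exists m; split; last by apply: hs; rewrite inE.
apply/eqP => m0; have := ls [:: 1] erefl; rewrite big_ord1 /= m0 scaler0.
by move=> /(_ erefl 0%N) /= /eqP; rewrite oner_eq0.
Qed.

Lemma in_span_not_infinite_dim (P : M -> Prop) (t : seq M) :
  subspace P -> (forall x, P x -> in_span t x) -> ~ infinite_dim P.
Proof.
move=> sP ht /(infinite_dim_ker_span sP lin_id ht) /infinite_dim_neq0.
by move=> [m [/eqP m0 [_]]].
Qed.

(** Unless some finite list spans [P], an independent list can always be lengthened by a vector of
    [P] outside its span. *)
Lemma not_infinite_dim_span (P : M -> Prop) :
  ~ infinite_dim P -> exists t, forall x, P x -> in_span t x.
Proof.
move=> hP; apply: NNPP => hn; apply: hP.
elim=> [|n [s [sn [hs ls]]]].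
  by exists [::]; split => //; split => // -[] // _ _ i; rewrite nth_nil.
have {hn} [x [Px hx]] : exists x, P x /\ ~ in_span s x.
  apply: NNPP => H; apply: hn; exists s => x Px.
  by apply: NNPP => hx; apply: H; exists x.
exists (x :: s); split; first by rewrite /= sn.
split; first by move=> m; rewrite inE => /orP [/eqP -> //|/hs].
move=> [//|a0 a] /= [sa]; rewrite big_ord_recl /= => h0.
have a00 : a0 = 0.
  apply/eqP/negP => /negP a0N; apply: hx; exists (fun i => - a0^-1 * a`_i).
  apply: (scalerI a0N); rewrite scaler_sumr.
  have /eqP := h0; rewrite addr_eq0 => /eqP ->.
  rewrite -sumrN; apply: eq_bigr => i _.
  by rewrite scalerA mulNr mulrN mulVKf // scaleNr.
move: h0; rewrite a00 scale0r add0r => /(ls a sa) ha [|i] //=; exact: ha.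
Qed.

Lemma infinite_dim_ker (P Q : M -> Prop) (f : M -> M) :
  subspace P -> lin f -> (forall x, P x -> Q (f x)) -> ~ infinite_dim Q ->
  infinite_dim P -> infinite_dim (fun x => P x /\ f x = 0).
Proof.
move=> sP hf fQ /not_infinite_dim_span [t ht].
exact: (infinite_dim_ker_span sP hf (fun x Px => ht _ (fQ x Px))).
Qed.

Lemma subspace_ker (P : M -> Prop) f :
  subspace P -> lin f -> subspace (fun x => P x /\ f x = 0).
Proof.
move=> [P0 PD] hf; split; first by rewrite lin0.
by move=> a u v [Pu fu] [Pv fv]; rewrite hf fu fv scaler0 addr0; split => //; apply: PD.
Qed.

End LinearAlgebra.

(** * Spans of families of eigenvectors *)

Section Families.
Context {k : fieldType} {M : lmodType k}.

(** [I] may be infinite, so a combination is a finite list of coefficient-index pairs, repetitions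
    allowed. *)
Definition in_lin (I : Type) (T : I -> M) (m : M) : Prop :=
  exists s : seq (k * I), m = \sum_(p <- s) p.1 *: T p.2.

Lemma in_lin_subspace (I : Type) (T : I -> M) : subspace (in_lin T).
Proof.
split; first by exists [::]; rewrite big_nil.
move=> a u v [s ->] [t ->]; exists ([seq (a * p.1, p.2) | p <- s] ++ t).
rewrite big_cat big_map scaler_sumr; congr (_ + _).
by apply: eq_bigr => p _; rewrite scalerA.
Qed.

Lemma in_lin_mem (I : Type) (T : I -> M) i : in_lin T (T i).
Proof. by exists [:: (1, i)]; rewrite big_seq1 scale1r. Qed.

Lemma subspaceZ (N : M -> Prop) (a : k) u : subspace N -> N u -> N (a *: u).
Proof. by move=> [N0 ND] Nu; rewrite -[_ *: _]addr0; apply: ND. Qed.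

Lemma subspaceD (N : M -> Prop) u v : subspace N -> N u -> N v -> N (u + v).
Proof. by move=> [N0 ND] Nu; rewrite -[u]scale1r; apply: ND; rewrite ?scale1r. Qed.

Lemma in_lin_stable (I : Type) (T : I -> M) f : lin f ->
  (forall i, in_lin T (f (T i))) -> forall m, in_lin T m -> in_lin T (f m).
Proof.
move=> hf hT m [s ->]; rewrite lin_sum //.
have sP := in_lin_subspace T.
apply: big_ind => [|u v|p _]; first exact: sP.1.
  exact: subspaceD.
by rewrite linZ //; apply: subspaceZ.
Qed.

Lemma weight_subspace (f : M -> M) (mu : k) :
  lin f -> subspace (weight_space f mu).
Proof.
move=> hf; split; first by rewrite /weight_space lin0 // scaler0.
move=> a u v; rewrite /weight_space hf => -> ->.
by rewrite scalerDr !scalerA mulrC.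
Qed.

(** Induction on the number of terms: [f - w i] kills the leading term, rescales the others and
    multiplies [m] by the nonzero scalar [mu - w i]. *)
Lemma eigenvector_sum0 (I : Type) (T : I -> M) (w : I -> k) f (mu : k) s m :
  lin f -> (forall i, f (T i) = w i *: T i) -> f m = mu *: m ->
  all (fun p => w p.2 != mu) s -> m = \sum_(p <- s) p.1 *: T p.2 -> m = 0.
Proof.
move=> hf hT; have [n] := ubnP (size s).
elim: n s m => // n IH [|[b i] s] m /=; first by rewrite big_nil.
rewrite ltnS => sn hm /andP [hi hs]; rewrite big_cons /= => mE.
have ne : mu - w i != 0 by rewrite subr_eq0 eq_sym.
apply: (scalerI ne); rewrite scaler0.
apply: (IH [seq (p.1 * (w p.2 - w i), p.2) | p <- s]).
- by rewrite size_map.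
- by rewrite linZ // hm !scalerA mulrC.
- by rewrite all_map; apply: sub_all hs.
rewrite big_map scalerBl -hm [in f m]mE [in w i *: m]mE.
rewrite linD // linZ // hT lin_sum // scalerDr !scalerA mulrC opprD addrACA subrr.
rewrite add0r scaler_sumr -sumrB; apply: eq_bigr => p _ /=.
rewrite linZ // hT !scalerA -scalerBl; congr (_ *: _); ring.
Qed.

(** The terms of weight other than [mu] add up to an eigenvector for [mu], hence to zero by
    [eigenvector_sum0]; only indices in [L] remain. *)
Lemma weight_space_in_span (I : eqType) (T : I -> M) (w : I -> k) f mu (L : seq I) :
  lin f -> (forall i, f (T i) = w i *: T i) -> (forall m, in_lin T m) ->
  (forall i, w i = mu -> i \in L) ->
  forall m, weight_space f mu m -> in_span [seq T i | i <- L] m.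
Proof.
move=> hf hT hT1 hL m hm; have [s ms] := hT1 m.
have sE : f (\sum_(p <- s | w p.2 == mu) p.1 *: T p.2) =
          mu *: \sum_(p <- s | w p.2 == mu) p.1 *: T p.2.
  rewrite lin_sum // scaler_sumr; apply: eq_bigr => p /eqP hp.
  by rewrite linZ // hT hp !scalerA mulrC.
have : m - \sum_(p <- s | w p.2 == mu) p.1 *: T p.2 = 0.
  apply: (@eigenvector_sum0 I T w f mu [seq p <- s | w p.2 != mu]) => //.
  - by rewrite linD // linN // hm sE -scalerN -scalerDr.
  - exact: filter_all.
  rewrite {1}ms (bigID (fun p => w p.2 == mu)) /= addrAC subrr add0r.
  by rewrite big_filter.
move=> /eqP; rewrite subr_eq0 => /eqP ->.
apply: big_ind => [|u v hu hv|p /eqP hp]; first exact: in_span0.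
  by rewrite -[u]scale1r; apply: in_span_lin.
rewrite -[_ *: _]addr0; apply: in_span_lin; last exact: in_span0.
by apply/in_span_mem/map_f/hL.
Qed.

End Families.

(** * Simple modules and the vanishing of extremal weight vectors *)

Section SimpleModules.
Context {k : fieldType} {M : lmodType k}.
Implicit Types (e : int -> M -> M) (g : k).

(* A simple Virasoro module on which c acts as the scalar g. *)
Definition simple_vir e g : Prop :=
  [/\ forall i, lin (e i),
      forall i j m, e i (e j m) = e j (e i m) + ((j - i)%:~R *: e (i + j) m
        + (if i == - j then ((i ^+ 3 - i)%:~R / 12%:R * g) *: m else 0)) &
      forall N, subspace N -> (forall i u, N u -> N (e i u)) ->
        (forall m, N m -> m = 0) \/ (forall m, N m)].

(* Twist by the involution e_i |-> - e_{-i}, c |-> - c. *)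
Definition mirror e : int -> M -> M := fun i m => - e (- i) m.

(** The cocycle [i ^+ 3 - i] is odd in [i], which is why the central charge changes sign. *)
Lemma mirror_simple_vir e g : simple_vir e g -> simple_vir (mirror e) (- g).
Proof.
move=> [he hb hs]; split.
- by move=> i a u v; rewrite /mirror he opprD scalerN.
- move=> i j m; rewrite /mirror !(linN _ (he _)) !opprK hb; congr (_ + _).
  have -> : - j - - i = - (j - i) by ring.
  rewrite -opprD rmorphN scaleNr scalerN; congr (_ + _).
  rewrite eqr_opp; case: eqP => // _; congr (_ *: _).
  have -> : (- i) ^+ 3 - - i = - (i ^+ 3 - i) by ring.
  by rewrite rmorphN mulrN !mulNr.
- move=> N sN hN; apply: hs => // i u Nu.
  have := hN (- i) u Nu; rewrite /mirror opprK => /(subspaceZ (-1) sN).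
  by rewrite scaleN1r opprK.
Qed.

Lemma weight_mirror e mu m :
  weight_space (e 0) mu m -> weight_space (mirror e 0) (- mu) m.
Proof. by rewrite /weight_space /mirror oppr0 => ->; rewrite scaleNr. Qed.

Lemma infinite_dim_mirror e mu :
  infinite_dim (weight_space (e 0) mu) <->
  infinite_dim (weight_space (mirror e 0) (- mu)).
Proof.
split; apply: infinite_dim_sub => m; first exact: weight_mirror.
by rewrite /weight_space /mirror oppr0 scaleNr => /oppr_inj.
Qed.

(** The boolean premise makes the central term vanish: either [i + j] is nonzero or [i ^+ 3 = i].
    With [l] and [d] as parameters, the side conditions at numerals hold by computation. *)
Lemma comm e g i j l d m : simple_vir e g -> i + j = l -> j - i = d ->
  (i == - j) ==> (i ^+ 3 == i) ->
  e i (e j m) = e j (e i m) + d%:~R *: e l m.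
Proof.
move=> [_ hb _] <- <-; rewrite hb; case: eqP => [_ /= /eqP ->|_ _].
  by rewrite subrr mulr0z !mul0r scale0r addr0.
by rewrite addr0.
Qed.

Lemma weight_e e g i nu m : simple_vir e g -> weight_space (e 0) nu m ->
  weight_space (e 0) (nu + i%:~R) (e i m).
Proof.
move=> h hm; rewrite /weight_space (comm (l := i) (d := i) _ h) ?add0r ?subr0 //.
  by case: h => he _ _; rewrite hm (linZ _ _ (he i)) scalerDl.
by rewrite expr0n eqxx implybT.
Qed.

Lemma full_of_stable e g (N : M -> Prop) m0 : simple_vir e g -> subspace N ->
  (forall i u, N u -> N (e i u)) -> N m0 -> m0 != 0 -> forall m, N m.
Proof.
move=> [_ _ hs] sN hN Nm0 /eqP m0N; case: (hs N sN hN) => // hN0.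
by case: m0N; apply: hN0.
Qed.

(* The letter i of a word stands for the lowering operator e_{-(i+1)}. *)
Fixpoint bounded_words (n f : nat) : seq (seq nat) :=
  if f is f'.+1 then
    [::] :: [seq i :: w | i <- iota 0 n, w <- bounded_words n f']
  else [:: [::]].

Lemma mem_bounded_words n f (w : seq nat) :
  (size w <= f)%N -> all (fun i => i < n)%N w -> w \in bounded_words n f.
Proof.
elim: f w => [|f IH] [|i w] //= hs /andP [hi hw].
rewrite inE; apply/orP; right; apply/allpairsP; exists (i, w) => /=.
by split => //; [rewrite mem_iota | apply: IH].
Qed.

Definition word_degree (w : seq nat) : nat := sumn (map succn w).

(** A letter [i] contributes [i + 1] to the degree, so the degree bounds both the length and the
    letters. Hence only finitely many words have a given degree. *)
Lemma word_degree_bounded (w : seq nat) :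
  w \in bounded_words (word_degree w) (word_degree w).
Proof.
apply: mem_bounded_words; rewrite /word_degree.
  by elim: w => //= i w IH; lia.
apply/allP => i; elim: w => //= j w IH; rewrite inE => /orP [/eqP ->|/IH]; lia.
Qed.

(** A nonzero [v] would generate a highest weight module: words of degree [d] applied to [v] have
    weight [nu - d] and together span [M], so its weight spaces would be finite-dimensional. *)
Lemma highest_weight_eq0 e g nu z v : [pchar k] =i pred0 -> simple_vir e g ->
  infinite_dim (weight_space (e 0) (nu + z%:~R)) ->
  weight_space (e 0) nu v -> e 1 v = 0 -> e 2 v = 0 -> v = 0.
Proof.
move=> /pcharf0P hk h hinf hv h1 h2; have [he hb hs] := h.
apply: NNPP => v0; move: hinf.
(* [[e_1, e_{n+2}] = (n+1) e_{n+3}], so [e_1] and [e_2] generate all [e_n] with [n > 0]. *)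
have hpos (n : nat) : e n.+1%:Z v = 0.
  elim: n => // -[|n IH] //.
  have := @comm e g 1 n.+2%:Z n.+3%:Z n.+1%:Z v h.
  rewrite IH (lin0 (he _)) h1 (lin0 (he _)) add0r expr1n eqxx implybT.
  move=> /(_ ltac:(lia) ltac:(lia) isT) /esym /eqP.
  by rewrite scaler_eq0 -pmulrn hk /= => /eqP.
pose T (w : seq nat) := foldr (fun i x => e (- i.+1%:Z) x) v w.
pose wt (w : seq nat) := nu - (word_degree w)%:R.
have hT w : e 0 (T w) = wt w *: T w.
  rewrite /wt /word_degree; elim: w => [|i w IH] /=; first by rewrite subr0.
  rewrite (weight_e (- i.+1%:Z) h IH) /=; congr (_ *: _).
  by rewrite natrD rmorphN /= -pmulrn; ring.
have sT := in_lin_subspace T.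
(* Induction on the word: moving [e_j] past the first letter leaves another [e] applied to the
   shorter word, plus a multiple of that word. *)
have stT j w : in_lin T (e j (T w)).
  elim: w j => [|i w IH] [j|j] /=.
  - case: j => [|j]; last by rewrite hpos; apply: sT.1.
    by rewrite (hv : e 0 v = _); exact: (subspaceZ _ sT (in_lin_mem T [::])).
  - by rewrite NegzE; apply: (in_lin_mem T [:: j]).
  - rewrite hb; apply: subspaceD => //.
      apply: in_lin_stable => // w'; exact: (in_lin_mem T (i :: w')).
    apply: subspaceD => //; first exact: subspaceZ.
    by case: ifP => _; [exact: (subspaceZ _ sT (in_lin_mem T w)) | exact: sT.1].
  - by rewrite NegzE; apply: (in_lin_mem T [:: j, i & w]).
have hfull : forall m, in_lin T m.
  apply: (full_of_stable h sT _ (in_lin_mem T [::])); last exact/eqP.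
  by move=> i; apply: in_lin_stable.
apply: (@in_span_not_infinite_dim _ _ _
  [seq T w | w <- bounded_words `|z|%N `|z|%N]).
  exact: weight_subspace.
apply: (weight_space_in_span (w := wt)) => // w /addrI.
move=> /eqP; rewrite eq_sym -subr_eq0 opprK pmulrn -intrD => /eqP.
case hz: (_ + _) => [n|n]; last first.
  by rewrite NegzE rmorphN /= -pmulrn => /eqP; rewrite oppr_eq0 hk.
rewrite -pmulrn => /eqP; rewrite hk => /eqP n0.
have <- : word_degree w = `|z|%N by lia.
exact: word_degree_bounded.
Qed.

Lemma lowest_weight_eq0 e g nu z v : [pchar k] =i pred0 -> simple_vir e g ->
  infinite_dim (weight_space (e 0) (nu + z%:~R)) ->
  weight_space (e 0) nu v -> e (-1) v = 0 -> e (-2) v = 0 -> v = 0.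
Proof.
move=> hk /mirror_simple_vir h /infinite_dim_mirror.
rewrite opprD -rmorphN => hinf /weight_mirror hv h1 h2.
by apply: (highest_weight_eq0 hk h hinf hv); rewrite /mirror ?h1 ?h2 oppr0.
Qed.

End SimpleModules.

(** * Relations satisfied next to a finite-dimensional weight space *)

Section GapRelations.
Context {k : fieldType} {M : lmodType k}.
Implicit Types (e : int -> M -> M) (g mu r : k).

(** When [r * (4 mu + 6) = -3], this degree-two operator sends a vector of weight [mu + 1] killed by
    [e_{-1}] to a vector again killed by [e_{-1}]. *)
Definition qop e r (b : M) : M := e 2 b + r *: e 1 (e 1 b).

Lemma lin_qop e g r : simple_vir e g -> lin (qop e r).
Proof.
by move=> [he _ _]; apply: lin_lincomb => //; apply: lin_comp.
Qed.

Lemma weight_qop e g r nu b : simple_vir e g -> weight_space (e 0) nu b ->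
  weight_space (e 0) (nu + 2%:~R) (qop e r b).
Proof.
move=> h hb; have [he _ _] := h; rewrite /weight_space /qop.
rewrite (linD _ _ (he 0)) (linZ _ _ (he 0)) (weight_e 2 h hb).
rewrite (weight_e 1 h (weight_e 1 h hb)) scalerDr !scalerA.
by congr (_ + _ *: _); ring.
Qed.

(** [e_{-1}], [e_0], [e_1] span a copy of sl_2 with [[e_{-1}, e_1] = 2 e_0], and [b] is a lowest
    weight vector for it. The first three coefficients are twice the sums of the successive weights
    from [mu + 1] on. *)
Lemma sl2_lowering e g mu b : simple_vir e g ->
  weight_space (e 0) (mu + 1) b -> e (-1) b = 0 ->
  [/\ e (-1) (e 1 b) = (2%:R * mu + 2%:R) *: b,
      e (-1) (e 1 (e 1 b)) = (4%:R * mu + 6%:R) *: e 1 b,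
      e (-1) (e 1 (e 1 (e 1 b))) = (6%:R * mu + 12%:R) *: e 1 (e 1 b) &
      e (-1) (e 2 b) = 3%:R *: e 1 b].
Proof.
move=> h hb hb1; have [he _ _] := h.
have w1 := weight_e 1 h hb; have w2 := weight_e 1 h w1.
have cm x := @comm _ _ e g (-1) 1 0 2 x h erefl erefl isT.
have e1 : e (-1) (e 1 b) = (2%:R * mu + 2%:R) *: b.
  rewrite cm hb1 (lin0 (he _)) add0r hb scalerA; congr (_ *: _); ring.
have e2 : e (-1) (e 1 (e 1 b)) = (4%:R * mu + 6%:R) *: e 1 b.
  rewrite cm e1 (linZ _ _ (he _)) w1 scalerA -scalerDl; congr (_ *: _); ring.
split => //.
  rewrite cm e2 (linZ _ _ (he _)) w2 scalerA -scalerDl; congr (_ *: _); ring.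
by rewrite (@comm _ _ e g (-1) 2 1 3 b h erefl erefl isT) hb1 (lin0 (he _)) add0r.
Qed.

(** The value of [r] makes [e_{-1}] kill [p = qop e r b]. The last two conditions then force
    [e_{-2}^2 p], [e_{-2} p] and [p] to vanish, in this order. *)
Lemma qop_eq0 e g mu z r b : [pchar k] =i pred0 -> simple_vir e g ->
  infinite_dim (weight_space (e 0) (mu + z%:~R)) -> mu != 1 ->
  r * (4%:R * mu + 6%:R) = - 3%:R ->
  weight_space (e 0) (mu + 1) b -> e (-1) b = 0 -> e (-3) (qop e r b) = 0 ->
  e 1 (e (-2) (e (-2) (qop e r b))) = 0 -> qop e r b = 0.
Proof.
move=> hk h hinf mu1 hr hb hb1; have [he _ _] := h.
have hk0 n : (n.+1%:R == 0 :> k) = false by move/pcharf0P: hk => ->.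
have [_ e2 _ e3] := sl2_lowering h hb hb1.
set p := qop e r b; move=> p3 hz1.
have p1 : e (-1) p = 0.
  rewrite /p /qop (linD _ _ (he _)) (linZ _ _ (he _)) e2 e3 scalerA -scalerDl.
  by rewrite hr subrr scale0r.
have wp : weight_space (e 0) (mu + 3%:~R) p.
  have := weight_qop r h hb; rewrite -addrA.
  by congr (weight_space _ (_ + _) _); ring.
have p4 : e (-4) p = 0.
  have := @comm _ _ e g (-3) (-1) (-4) 2 p h erefl erefl isT.
  rewrite p1 p3 !(lin0 (he _)) add0r => /esym /eqP.
  by rewrite scaler_eq0 hk0 => /eqP.
have p5 : e (-5) p = 0.
  have := @comm _ _ e g (-4) (-1) (-5) 3 p h erefl erefl isT.
  rewrite p1 p4 !(lin0 (he _)) add0r => /esym /eqP.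
  by rewrite scaler_eq0 hk0 => /eqP.
(* p is killed by e_{-1} and all e_{-j}, j >= 3, so it vanishes once w does;
   likewise w vanishes once y does. *)
pose w := e (-2) p; pose y := e (-2) w.
have ww : weight_space (e 0) (mu + 3%:~R + (-2)%:~R) w := weight_e (-2) h wp.
have wy : weight_space (e 0) (mu + 3%:~R + (-2)%:~R + (-2)%:~R) y := weight_e (-2) h ww.
have w1 : e (-1) w = 0.
  rewrite /w (@comm _ _ e g (-1) (-2) (-3) (-1) p h erefl erefl isT) p1 p3.
  by rewrite (lin0 (he _)) scaler0 addr0.
have w3 : e (-3) w = 0.
  rewrite /w (@comm _ _ e g (-3) (-2) (-5) 1 p h erefl erefl isT) p5 p3.
  by rewrite (lin0 (he _)) scaler0 addr0.
have y1 : e (-1) y = 0.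
  rewrite /y (@comm _ _ e g (-1) (-2) (-3) (-1) w h erefl erefl isT) w1 w3.
  by rewrite (lin0 (he _)) scaler0 addr0.
(* [y] has weight [mu - 1] and is killed by [e_1] and [e_{-1}], hence by [[e_1, e_{-1}] = -2 e_0];
   this is where [mu != 1] enters. *)
have y0 : y = 0.
  have := @comm _ _ e g 1 (-1) 0 (-2) y h erefl erefl isT.
  rewrite (_ : e 1 y = 0) // y1 !(lin0 (he _)) add0r wy scalerA => /esym /eqP.
  rewrite scaler_eq0 => /orP [|/eqP //].
  have -> : ((-2)%:~R * (mu + 3%:~R + (-2)%:~R + (-2)%:~R) : k)
            = 2%:R * (1 - mu) by ring.
  by rewrite mulf_eq0 hk0 subr_eq0 eq_sym (negPf mu1).
have w0 : w = 0.
  apply: (lowest_weight_eq0 (z := z - 1) hk h _ ww w1 y0).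
  suff -> : mu + 3%:~R + (-2)%:~R + (z - 1)%:~R = mu + z%:~R by [].
  rewrite intrB; ring.
apply: (lowest_weight_eq0 (z := z - 3) hk h _ wp p1 w0).
suff -> : mu + 3%:~R + (z - 3)%:~R = mu + z%:~R by [].
rewrite intrB; ring.
Qed.

(** As [e_1 a = 0], the vectors [e_3 a], [e_4 a], [e_5 a] are multiples of powers of [e_1] on [b].
    The identity [[e_2, e_3] a = e_5 a] thus becomes a relation on [b], and lowering it by [e_{-1}]
    yields a condition on [mu]. *)
Lemma gap_weight_eq0_or_1 e g mu z r a : [pchar k] =i pred0 -> simple_vir e g ->
  infinite_dim (weight_space (e 0) (mu + z%:~R)) ->
  r * (4%:R * mu + 6%:R) = - 3%:R ->
  weight_space (e 0) (mu - 1) a -> a != 0 ->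
  e 1 a = 0 -> e (-1) (e 2 a) = 0 -> qop e r (e 2 a) = 0 ->
  mu = 0 \/ mu = 1.
Proof.
move=> hk h hinf hr wa a0 a1; have [he _ _] := h.
have hk0 n : (n.+1%:R == 0 :> k) = false by move/pcharf0P: hk => ->.
have infw (s : int) : infinite_dim (weight_space (e 0) (mu + s%:~R + (z - s)%:~R)).
  suff -> : mu + s%:~R + (z - s)%:~R = mu + z%:~R by [].
  rewrite intrB; ring.
set b := e 2 a => b1 hq.
have wb : weight_space (e 0) (mu + 1) b.
  have := weight_e 2 h wa; rewrite -addrA.
  by congr (weight_space _ (_ + _) _); ring.
have b0 : b != 0.
  apply/eqP => b0; case/eqP: a0.
  by apply: (highest_weight_eq0 hk h (infw (-1))) => //; rewrite rmorphN.
have [f1 f2 f3 _] := sl2_lowering h wb b1.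
have e2b : e 2 b = - r *: e 1 (e 1 b).
  by apply/eqP; rewrite scaleNr -addr_eq0; apply/eqP.
have e3a : e 3 a = e 1 b.
  rewrite /b (@comm _ _ e g 1 2 3 1 a h erefl erefl isT) a1 (lin0 (he _)).
  by rewrite add0r scale1r.
have e4a : e 1 (e 1 b) = 2%:R *: e 4 a.
  rewrite -e3a (@comm _ _ e g 1 3 4 2 a h erefl erefl isT) a1 (lin0 (he _)).
  by rewrite add0r.
have e5a : e 1 (e 1 (e 1 b)) = 6%:R *: e 5 a.
  rewrite e4a (linZ _ _ (he _)) (@comm _ _ e g 1 4 5 3 a h erefl erefl isT).
  by rewrite a1 (lin0 (he _)) add0r scalerA; congr (_ *: _); ring.
have c23 : e 2 (e 1 b) = e 3 b + e 5 a.
  by rewrite -e3a (@comm _ _ e g 2 3 5 1 a h erefl erefl isT) scale1r.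
have c12 : e 1 (e 2 b) = e 2 (e 1 b) + e 3 b.
  by rewrite (@comm _ _ e g 1 2 3 1 b h erefl erefl isT) scale1r.
have rel : 12%:R *: e 2 (e 1 b) = (1 - 6%:R * r) *: e 1 (e 1 (e 1 b)).
  have : 2%:R *: e 2 (e 1 b) = e 1 (e 2 b) + e 5 a.
    by rewrite c12 -addrA -c23 -mulr2n scaler_nat.
  move=> /(congr1 (fun x => 6%:R *: x)); rewrite scalerA scalerDr -e5a e2b.
  rewrite (linZ _ _ (he _)) scalerA -{2}[e 1 (e 1 (e 1 b))]scale1r -scalerDl.
  have -> : (6%:R * 2%:R : k) = 12%:R by ring.
  by move=> ->; congr (_ *: _); ring.
(* Apply e_{-1} to rel. *)
have : (24%:R * (mu * (1 - mu))) *: e 1 (e 1 b) = 0.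
  have : e (-1) (12%:R *: e 2 (e 1 b)) =
         e (-1) ((1 - 6%:R * r) *: e 1 (e 1 (e 1 b))) by rewrite rel.
  rewrite !(linZ _ _ (he _)) f3 (@comm _ _ e g (-1) 2 1 3 _ h erefl erefl isT).
  rewrite f1 (linZ _ _ (he _)) e2b !(scalerDr, scalerA) -scalerDl => /eqP.
  (* Multiplying by [4 mu + 6] eliminates [r] through [hr]; the coefficient left is
     [24 mu (1 - mu)]. *)
  rewrite -subr_eq0 -scalerBl => /eqP /(congr1 (fun x => (4%:R * mu + 6%:R) *: x)).
  rewrite scalerA scaler0 => H; rewrite -[RHS]H; congr (_ *: _).
  have -> : 24%:R * (mu * (1 - mu)) = 36%:R * (4%:R * mu + 6%:R)
      - (6%:R * mu + 12%:R) * (4%:R * mu + 6%:R)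
      + (- 3%:R) * (6%:R * (6%:R * mu + 12%:R) - 24%:R * (mu + 1)) by ring.
  by rewrite -hr; ring.
move=> /eqP; rewrite scaler_eq0 mulf_eq0 hk0 mulf_eq0 subr_eq0 /=.
case/orP => [/orP [/eqP ->|/eqP <-]|/eqP g0]; [by left|by right|].
(* If [e_1 (e_1 b) = 0], then [e_1 b = 0] because [hr] makes [4 mu + 6] nonzero, and [e_2 b = 0] as
   well, so [b] is a highest weight vector. *)
case/eqP: b0; apply: (highest_weight_eq0 hk h (infw 1) wb).
  have /esym/eqP := f2; rewrite g0 (lin0 (he _)) scaler_eq0 => /orP [|/eqP //].
  move=> /eqP H; move: hr => /eqP; rewrite H mulr0 eq_sym oppr_eq0.
  by rewrite hk0.
by rewrite e2b g0 scaler0.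
Qed.

Lemma weight_mirrorE e nu m :
  weight_space (mirror e 0) nu m -> weight_space (e 0) (- nu) m.
Proof. by rewrite /weight_space /mirror oppr0 scaleNr => <-; rewrite opprK. Qed.

(* Every condition imposed on a is the vanishing of an operator of degree 1,
   that is, of a map from an infinite-dimensional weight space to a
   finite-dimensional one. *)
Lemma gap_vector e g mu r r' : simple_vir e g ->
  infinite_dim (weight_space (e 0) (mu - 1)) ->
  ~ infinite_dim (weight_space (e 0) mu) ->
  exists a : M, [/\ a != 0 /\ weight_space (e 0) (mu - 1) a,
    e 1 a = 0 /\ e (-1) (e 2 a) = 0,
    e (-3) (qop e r (e 2 a)) = 0 /\ e 1 (e (-2) (e (-2) (qop e r (e 2 a)))) = 0 &
    mirror e (-3) (qop (mirror e) r' a) = 0 /\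
    mirror e 1 (mirror e (-2) (mirror e (-2) (qop (mirror e) r' a))) = 0].
Proof.
move=> h; have h' := mirror_simple_vir h; have [he _ _] := h; have [he' _ _] := h'.
move=> hinf hfin.
have s0 := weight_subspace (mu - 1) (he 0).
pose step f P := @infinite_dim_ker k M P (weight_space (e 0) mu) f.
have lq := lin_qop r h; have lq' := lin_qop r' h'.
have l1 := he 1; have l2 := lin_comp (he (-1)) (he 2).
have l3 := lin_comp (he (-3)) (lin_comp lq (he 2)).
have l4 := lin_comp (he 1) (lin_comp (he (-2)) (lin_comp (he (-2)) (lin_comp lq (he 2)))).
have l5 := lin_comp (he' (-3)) lq'.
have l6 := lin_comp (he' 1) (lin_comp (he' (-2)) (lin_comp (he' (-2)) lq')).
have wE x nu : weight_space (e 0) nu x -> nu = mu -> weight_space (e 0) mu x.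
  by move=> ? <-.
have wE' x nu : weight_space (mirror e 0) nu x -> nu = - mu -> weight_space (e 0) mu x.
  by move=> /weight_mirrorE H hn; move: H; rewrite hn opprK.
have s1 := subspace_ker s0 l1; have s2 := subspace_ker s1 l2.
have s3 := subspace_ker s2 l3; have s4 := subspace_ker s3 l4.
have s5 := subspace_ker s4 l5.
have i1 := step _ _ s0 l1
  (fun x hx => wE _ _ (weight_e 1 h hx) ltac:(ring))
  hfin hinf.
have i2 := step _ _ s1 l2
  (fun x hx => wE _ _ (weight_e (-1) h (weight_e 2 h hx.1)) ltac:(ring))
  hfin i1.
have i3 := step _ _ s2 l3
  (fun x hx => wE _ _ (weight_e (-3) h (weight_qop r h
  (weight_e 2 h hx.1.1))) ltac:(ring))
  hfin i2.
have i4 := step _ _ s3 l4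
  (fun x hx => wE _ _ (weight_e 1 h (weight_e (-2) h (weight_e (-2) h
  (weight_qop r h (weight_e 2 h hx.1.1.1))))) ltac:(ring))
  hfin i3.
have i5 := step _ _ s4 l5
  (fun x hx => wE' _ _ (weight_e (-3) h' (weight_qop r' h'
  (weight_mirror hx.1.1.1.1))) ltac:(ring))
  hfin i4.
have i6 := step _ _ s5 l6
  (fun x hx => wE' _ _ (weight_e 1 h' (weight_e (-2) h' (weight_e (-2) h'
  (weight_qop r' h' (weight_mirror hx.1.1.1.1.1))))) ltac:(ring))
  hfin i5.
have [a [a0 [[[[[[wa ?] ?] ?] ?] ?] ?]]] := infinite_dim_neq0 i6.
by exists a.
Qed.

End GapRelations.

Lemma intr_eq0_pchar0 (R : fieldType) (z : int) :
  [pchar R] =i pred0 -> (z%:~R == 0 :> R) = (z == 0).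
Proof.
move=> /pcharf0P hR; case: z => n; first by rewrite -pmulrn hR.
by rewrite NegzE rmorphN /= oppr_eq0 -pmulrn hR oppr_eq0.
Qed.

(** * Recognizing the module k[t, 1/t] / k *)

Section DensityModule.
Context {k : fieldType} {M : lmodType k}.
Implicit Types (e : int -> M -> M) (g mu r : k) (T : int -> M).

(* T n plays the role of t^n in k[t, 1/t] / k, where e_m acts as t^(m+1) d/dt. *)
Definition acts_as_density e T (m : int) (n : int) : Prop :=
  e m (T n) = n%:~R *: T (n + m).

Lemma comm0 e i j m : simple_vir e 0 ->
  e i (e j m) = e j (e i m) + (j - i)%:~R *: e (i + j) m.
Proof. by move=> [_ -> _]; rewrite mulr0 scale0r; case: ifP; rewrite addr0. Qed.

Lemma acts_as_density_bracket e T i j : [pchar k] =i pred0 -> simple_vir e 0 ->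
  i != j -> (forall n, acts_as_density e T i n) ->
  (forall n, acts_as_density e T j n) ->
  forall n, acts_as_density e T (i + j) n.
Proof.
move=> hk h ij hi hj n; have [he _ _] := h; rewrite /acts_as_density in hi hj *.
have := comm0 i j (T n) h; rewrite hi hj.
rewrite !(linZ _ _ (he _)) hi hj !scalerA -!addrA [j + i]addrC.
move=> H.
have ne : (j - i)%:~R != 0 :> k.
  by rewrite intr_eq0_pchar0 // subr_eq0 eq_sym.
apply: (scalerI ne); move: H => /esym /(canRL (addKr _)) ->.
rewrite scalerA -scaleNr -scalerDl; congr (_ *: _).
by rewrite !intrD rmorphN; ring.
Qed.

(** From [e_2] on, bracketing with [e_1] gives the next operator, and likewise downwards. [e_2] and
    [e_{-2}] must be supplied because [[e_1, e_1] = 0]. *)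
Lemma acts_as_density_all e T : [pchar k] =i pred0 -> simple_vir e 0 ->
  (forall m n, m \in [:: 0; 1; -1; 2; -2] -> acts_as_density e T m n) ->
  forall m n, acts_as_density e T m n.
Proof.
move=> hk h h5.
have hpos (d : nat) n : acts_as_density e T d n.
  elim: d n => [|d IH] n; first exact: h5.
  have [d2|d2] := leqP d 1; first by case: d d2 {IH} => [|[]] // _; apply: h5.
  rewrite -addn1 PoszD; apply: acts_as_density_bracket => //.
    by apply/eqP; lia.
  by move=> ?; apply: h5.
have hneg (d : nat) n : acts_as_density e T (- d%:Z) n.
  elim: d n => [|d IH] n; first exact: h5.
  have [d2|d2] := leqP d 1; first by case: d d2 {IH} => [|[]] // _; apply: h5.
  rewrite -addn1 PoszD opprD; apply: acts_as_density_bracket => //.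
    by apply/eqP; lia.
  by move=> ?; apply: h5.
by case=> d n; [apply: hpos | rewrite NegzE; apply: hneg].
Qed.

(** The formulas for [e_0], [e_{-1}], [e_{-2}] propagate from [T 1] by commuting past [e_1]. For
    [e_2] this would bring in the unknown [e_3], so the error term [d] is instead shown to be a
    lowest weight vector. *)
Lemma density_nonneg e z T : [pchar k] =i pred0 -> simple_vir e 0 ->
  infinite_dim (weight_space (e 0) z%:~R) ->
  T 0 = 0 -> (forall n : nat, acts_as_density e T 1 n.+1) ->
  acts_as_density e T 0 1 -> e (-1) (T 1) = 0 -> e 1 (T (-1)) = 0 ->
  e (-2) (T 1) = T (-1) -> e 2 (T (-1)) = - T 1 ->
  forall m (n : nat), m \in [:: 0; 1; -1; 2; -2] -> acts_as_density e T m n.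
Proof.
rewrite /acts_as_density => hk h hinf T0 rec z1 l1 u1 l2 u2; have [he _ _] := h.
have hk0 (n : nat) : n.+1%:~R != 0 :> k by rewrite -pmulrn; move/pcharf0P: hk => ->.
have recN n : e 1 (T n.+1%:Z) = n.+1%:~R *: T n.+2%:Z.
  by rewrite rec; congr (_ *: T _); lia.
have A1 (n : nat) : e 1 (T n) = n%:~R *: T n.+1%:Z.
  case: n => [|n]; last exact: recN.
  by rewrite T0 (lin0 (he _)) scale0r.
have A0 (n : nat) : e 0 (T n) = n%:~R *: T n.
  case: n => [|n]; first by rewrite T0 (lin0 (he _)) scaler0.
  elim: n => [|n IH]; first by rewrite z1 addr0.
  apply: (scalerI (hk0 n)); rewrite -(linZ _ _ (he _)) -recN.
  rewrite (@comm _ _ e 0 0 1 1 1 _ h erefl erefl isT) IH (linZ _ _ (he _)) recN.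
  by rewrite !scalerA -scalerDl; congr (_ *: _); rewrite !intS !intrD; ring.
have B1 (n : nat) : e (-1) (T n.+1%:Z) = n.+1%:~R *: T n.
  elim: n => [|n IH]; first by rewrite T0 scaler0.
  apply: (scalerI (hk0 n)); rewrite -(linZ _ _ (he _)) -recN.
  rewrite (@comm _ _ e 0 (-1) 1 0 2 _ h erefl erefl isT) IH (linZ _ _ (he _)).
  rewrite A1 A0 !scalerA -scalerDl; congr (_ *: _).
  by rewrite !intS !intrD; ring.
have B2 (n : nat) : e (-2) (T n.+2%:Z) = n.+2%:~R *: T n.
  have c2 m : e (-2) (e 1 (T m)) = e 1 (e (-2) (T m)) + 3%:~R *: e (-1) (T m).
    exact: (@comm _ _ e 0 (-2) 1 (-1) 3 _ h erefl erefl isT).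
  elim: n {-2}n (leqnn n) => [|n IH] [|[|j]] // hj.
  - have := c2 1; rewrite recN scale1r => ->.
    by rewrite l2 u1 l1 scaler0 T0 scaler0 addr0.
  - have := c2 1; rewrite recN scale1r => ->.
    by rewrite l2 u1 l1 scaler0 T0 scaler0 addr0.
  - apply: (scalerI (hk0 1%N)); rewrite -(linZ _ _ (he _)) -recN c2.
    rewrite IH // B1 T0 scaler0 (lin0 (he _)) add0r !scalerA; congr (_ *: _).
    by rewrite !intS !intrD; ring.
  apply: (scalerI (hk0 j.+2)); rewrite -(linZ _ _ (he _)) -recN c2.
  rewrite (IH j.+1) // (linZ _ _ (he _)) A1 B1 !scalerA -scalerDl; congr (_ *: _).
  by rewrite !intS !intrD; ring.
have B2' (n : nat) : e (-2) (T n.+1%:Z) = n.+1%:~R *: T (n.+1%:Z - 2).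
  case: n => [|n]; first by rewrite l2 scale1r.
  by rewrite B2; congr (_ *: T _); lia.
(* The second formula is carried along because [e_{-2}] sends index [n + 1] to [n - 1], which is
   [-1] at the start. *)
have A2 (n : nat) : e 2 (T n) = n%:~R *: T n.+2%:Z /\
    e 2 (T (n%:Z - 1)) = (n%:Z - 1)%:~R *: T n.+1%:Z.
  elim: n => [|n [IH1 IH2]].
    by rewrite T0 (lin0 (he _)) scale0r u2 scaleN1r.
  have E1 : n.+1%:Z - 1 = n by lia.
  split; last by rewrite E1.
  pose d := e 2 (T n.+1%:Z) - n.+1%:~R *: T n.+3%:Z.
  suff : d = 0 by move=> /eqP; rewrite subr_eq0 => /eqP.
  have wd : weight_space (e 0) n.+3%:~R d.
    rewrite /weight_space /d (linD _ _ (he _)) (linN _ (he _)) (linZ _ _ (he _)).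
    rewrite A0 (@comm _ _ e 0 0 2 2 2 _ h erefl erefl isT) A0 (linZ _ _ (he _)).
    rewrite -scalerDl scalerBr !scalerA; congr (_ *: _ - _ *: _).
      by rewrite !intS !intrD; ring.
    exact: mulrC.
  apply: (lowest_weight_eq0 (z := z - n.+3%:Z) hk h _ wd).
  - by rewrite -intrD addrC subrK.
  - rewrite /d (linD _ _ (he _)) (linN _ (he _)) (linZ _ _ (he _)) B1.
    rewrite (@comm _ _ e 0 (-1) 2 1 3 _ h erefl erefl isT) B1 (linZ _ _ (he _)) IH1 A1.
    rewrite !scalerA -scalerDl -scalerBl; apply/eqP; rewrite scaler_eq0; apply/orP.
    by left; apply/eqP; rewrite !intS !intrD; ring.
  rewrite /d (linD _ _ (he _)) (linN _ (he _)) (linZ _ _ (he _)) B2.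
  rewrite (comm0 _ _ _ h) B2' (linZ _ _ (he _)).
  have -> : n.+1%:Z - 2 = n%:Z - 1 by lia.
  have -> : (-2 + 2 : int) = 0 by [].
  rewrite IH2 A0 !scalerA -scalerDl -scalerBl; apply/eqP; rewrite scaler_eq0.
  apply/orP; left; apply/eqP.
  by rewrite !intS !(intrD, intrB); ring.
move=> m n; rewrite !inE => /orP [|/orP [|/orP [|/orP []]]] /eqP ->.
- by rewrite addr0.
- by rewrite A1; congr (_ *: T _); lia.
- case: n => [|n]; first by rewrite T0 (lin0 (he _)) scale0r.
  by rewrite B1; congr (_ *: T _); lia.
- by rewrite (A2 n).1; congr (_ *: T _); lia.
case: n => [|n]; first by rewrite T0 (lin0 (he _)) scale0r.
by rewrite B2'.
Qed.

(** The involution combined with [n -> -n] preserves the density action, so negative indices reduce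
    to positive ones. *)
Lemma density_opp e T m n :
  acts_as_density (mirror e) (fun i => T (- i)) (- m) (- n) ->
  acts_as_density e T m n.
Proof.
rewrite /acts_as_density /mirror !opprK -opprD opprK rmorphN scaleNr.
exact: oppr_inj.
Qed.

End DensityModule.

(** * Excluding gaps, then the support and the central charge *)

Section NoGap.
Context {k : fieldType} {M : lmodType k}.
Implicit Types (e : int -> M -> M) (g mu : k).

(** Besides [0], the list keeps the values out of reach of [qop_eq0]: [mu = 1], and [mu = -3/2], for
    which no [r] exists. *)
Lemma gap_weights e g mu : [pchar k] =i pred0 -> simple_vir e g ->
  infinite_dim (weight_space (e 0) (mu - 1)) ->
  ~ infinite_dim (weight_space (e 0) mu) ->
  [\/ mu = 0, mu = 1 | 4%:R * mu + 6%:R = 0].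
Proof.
move=> hk h hinf hfin.
have [->|mu1] := eqVneq mu 1; first exact: Or32.
have [|hr] := eqVneq (4%:R * mu + 6%:R) 0; first exact: Or33.
pose r := - 3%:R / (4%:R * mu + 6%:R).
have hrE : r * (4%:R * mu + 6%:R) = - 3%:R by rewrite /r mulfVK.
have [a [[a0 wa] [a1 b1] [q3 q1] _]] := gap_vector r 0 h hinf hfin.
have hinf' : infinite_dim (weight_space (e 0) (mu + (-1)%:~R)) by rewrite rmorphN.
have wb : weight_space (e 0) (mu + 1) (e 2 a).
  have := weight_e 2 h wa; rewrite -addrA.
  by congr (weight_space _ (_ + _) _); ring.
have q0 := qop_eq0 hk h hinf' mu1 hrE wb b1 q3 q1.
have [m0|m1] := gap_weight_eq0_or_1 hk h hinf' hrE wa a0 a1 b1 q0.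
  exact: Or31.
exact: Or32.
Qed.

Lemma no_gap_at_0 e g : [pchar k] =i pred0 -> simple_vir e g ->
  infinite_dim (weight_space (e 0) (0 - 1)) ->
  infinite_dim (weight_space (e 0) 0).
Proof.
move=> hk h hinf; apply: NNPP => hfin.
have hk0 n : (n.+1%:R == 0 :> k) = false by move/pcharf0P: hk => ->.
have h2 : 2%:R != 0 :> k by rewrite hk0.
have [he hb _] := h; have h' := mirror_simple_vir h.
(* The solution of [r * (4 mu + 6) = -3] at [mu = 0]; it serves the mirrored module too, as
   [- 0 = 0]. *)
pose r : k := - 2%:R^-1.
have hr : r * (4%:R * 0 + 6%:R) = - 3%:R by rewrite /r; field.
have hr' : r * (4%:R * - 0 + 6%:R) = - 3%:R by rewrite oppr0.
have ne01 : (0 : k) != 1 by rewrite eq_sym oner_eq0.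
have ne01' : (- 0 : k) != 1 by rewrite oppr0.
have hinf1 : infinite_dim (weight_space (e 0) (0 + (-1)%:~R)) by rewrite rmorphN.
have hinf1' : infinite_dim (weight_space (mirror e 0) (- 0 + 1%:~R)).
  by have /infinite_dim_mirror := hinf; rewrite opprB addrC.
have [a [[a0 wa] [a1 b1] [q3 q1] [p3 p1]]] := gap_vector r r h hinf hfin.
pose b := e 2 a; rewrite -/b in b1 q3 q1.
have wb : weight_space (e 0) (0 + 1) b.
  have := weight_e 2 h wa; rewrite -addrA.
  by congr (weight_space _ (_ + _) _); ring.
have q0 := qop_eq0 hk h hinf1 ne01 hr wb b1 q3 q1.
(* In the mirrored module [a] itself has weight [1] and is killed by the mirrored [e_{-1}], so it
   takes the place of [b] in [qop_eq0]. *)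
have wa' : weight_space (mirror e 0) (- 0 + 1) a.
  by have := weight_mirror wa; rewrite opprB addrC.
have a1' : mirror e (-1) a = 0 by rewrite /mirror opprK a1 oppr0.
have p0 := qop_eq0 hk h' hinf1' ne01' hr' wa' a1' p3 p1.
have [f1 _ _ _] := sl2_lowering h wb b1.
have za : e 0 a = - a by rewrite wa sub0r scaleN1r.
have zb : e 0 b = b by rewrite wb add0r scale1r.
have b0 : b != 0.
  apply/eqP => b0; case/eqP: a0.
  apply: (highest_weight_eq0 (z := 0) hk h _ wa a1 b0).
  by rewrite addr0.
have e2b : e 2 b = - r *: e 1 (e 1 b).
  by apply/eqP; rewrite scaleNr -addr_eq0; apply/eqP.
have em2a : e (-2) a = r *: e (-1) (e (-1) a).
  by move: p0; rewrite /qop /mirror (linN _ (he _)) opprK => /eqP;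
     rewrite addrC subr_eq0 => /eqP ->.
have up1 : e 1 (e (-1) a) = 2%:R *: a.
  rewrite (@comm _ _ e g 1 (-1) 0 (-2) a h erefl erefl isT) a1 (lin0 (he _)) za.
  by rewrite add0r scalerN -scaleNr; congr (_ *: _); ring.
have up2 : e 2 (e (-2) a) = 3%:R *: a.
  have c x := @comm _ _ e g 2 (-1) 1 (-3) x h erefl erefl isT.
  rewrite em2a (linZ _ _ (he _)) !c -/b b1 a1 scaler0 addr0 (lin0 (he _)) add0r up1.
  by rewrite !scalerA; congr (_ *: _); rewrite /r; field.
have c22 x : e (-2) (e 2 x) = e 2 (e (-2) x) + (4%:R *: e 0 x - (g / 2%:R) *: x).
  rewrite hb /= -scaleNr; congr (_ + (_ + _ *: _)).
  have -> : ((-2) ^+ 3 - -2 : int) = - 6%:R by [].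
  have e26 : 12%:R = 6%:R * 2%:R :> k by ring.
  by rewrite rmorphN /= e26; field; rewrite h2 /= hk0.
have low1 : e (-2) b = (- 1 - g / 2%:R) *: a.
  rewrite /b c22 up2 za scalerN -!scaleNr -!scalerDl; congr (_ *: _); ring.
have low2 : e (-2) (e 1 (e 1 b)) = 6%:R *: b.
  have c x := @comm _ _ e g (-2) 1 (-1) 3 x h erefl erefl isT.
  rewrite !c b1 low1 (linZ _ _ (he _)) a1 !scaler0 addr0 (lin0 (he _)) add0r f1.
  by rewrite !scalerA; congr (_ *: _); ring.
(* [e_{-2} e_2 b] equals [(3 - g) b] by the bracket and [3 b] through [e2b]. *)
have g0 : g = 0.
  have := congr1 (e (-2)) e2b.
  rewrite c22 low1 !(linZ _ _ (he _)) low2 zb -/b -!scaleNr scalerA -!scalerDl.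
  move=> /eqP; rewrite -subr_eq0 -scalerBl scaler_eq0 (negPf b0) orbF => /eqP H.
  apply/eqP; rewrite -oppr_eq0 -H /r; apply/eqP; field.
  by rewrite h2.
move: h h'; rewrite g0 oppr0 => h h'.
(* [tp n] is the future [T (n + 1)] and [tm n] the future [T (- n - 1)], obtained from powers of
   [e_1], plain or mirrored, divided by [n!]. [T 0 = 0] reflects the quotient by constants, and the
   sign of [- b] gives [e_{-2} (T 1) = T (-1)]. *)
pose tp := fix tp n : M :=
  if n is n'.+1 then n'.+1%:R^-1 *: e 1 (tp n') else - b.
pose tm := fix tm n : M :=
  if n is n'.+1 then n'.+1%:R^-1 *: mirror e 1 (tm n') else a.
pose T (i : int) : M :=
  match i with Posz 0 => 0 | Posz n.+1 => tp n | Negz n => tm n end.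
have T1 : T 1 = - b by [].
have Tm1 : T (-1) = a by [].
have eT1 : e (-2) (T 1) = T (-1).
  rewrite T1 Tm1 (linN _ (he _)) low1 g0 mul0r subr0 scaleN1r opprK //.
have eTm1 : e 2 (T (-1)) = - T 1 by rewrite T1 Tm1 opprK.
have hkn n : n.+1%:R != 0 :> k by rewrite hk0.
have Ap := @density_nonneg _ _ e (-1) T hk h.
have Am := @density_nonneg _ _ (mirror e) 1 (fun i => T (- i)) hk h'.
have A m n : m \in [:: 0; 1; -1; 2; -2] -> acts_as_density e T m n.
  move=> hm; case: n => n.
    apply: Ap hm => //.
    - by move: hinf1; rewrite add0r.
    - move=> i; rewrite /acts_as_density.
      have -> : i.+1%:Z + 1 = i.+2%:Z by lia.
      by rewrite /= scalerA -pmulrn divff // scale1r.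
    - by rewrite /acts_as_density addr0 scale1r T1 (linN _ (he _)) zb.
    - by rewrite T1 (linN _ (he _)) b1 oppr0.
  apply: density_opp; rewrite NegzE opprK; apply: Am => //.
  - by move: hinf1'; rewrite oppr0 add0r.
  - move=> i; rewrite /acts_as_density.
    have -> : - (i.+1%:Z + 1) = Negz i.+1 by lia.
    by rewrite -NegzE /= scalerA -pmulrn divff // scale1r.
  - by rewrite /acts_as_density addr0 scale1r Tm1 /mirror oppr0 za opprK.
  - by rewrite /mirror !opprK T1 (linN _ (he _)) b1 !oppr0.
  - by rewrite /mirror (opprK (1 : int)) eT1.
  - by move: hm; rewrite !inE => /orP [|/orP [|/orP [|/orP []]]] /eqP ->.
have AA := acts_as_density_all hk h A.
have sT := in_lin_subspace T.
have hfull : forall m, in_lin T m.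
  apply: (full_of_stable h sT _ (in_lin_mem T (-1)) a0) => i.
  apply: in_lin_stable => // n; rewrite AA.
  exact: (subspaceZ _ sT (in_lin_mem T _)).
(* Only the index [-1] has weight [-1], so that weight space lies on one line, against [hinf]. *)
apply: (@in_span_not_infinite_dim _ _ _ [seq T i | i <- [:: (-1 : int)]] _ _ hinf).
  exact: weight_subspace.
apply: (weight_space_in_span (w := fun i : int => i%:~R)) => // i.
  by rewrite AA addr0.
rewrite sub0r inE => /eqP; rewrite -addr_eq0 -(intrD _ i 1).
by rewrite intr_eq0_pchar0 // addr_eq0.
Qed.

(** Otherwise [e_1] and [e_2] would share a nonzero kernel vector in weight [mu - 1], a highest
    weight vector. *)
Lemma two_steps_up e g mu : [pchar k] =i pred0 -> simple_vir e g ->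
  infinite_dim (weight_space (e 0) (mu - 1)) ->
  ~ infinite_dim (weight_space (e 0) mu) ->
  infinite_dim (weight_space (e 0) (mu + 1)).
Proof.
move=> hk h hinf hfin; apply: NNPP => hfin'; have [he _ _] := h.
have s0 := weight_subspace (mu - 1) (he 0); have s1 := subspace_ker s0 (he 1).
have i1 : infinite_dim (fun x => weight_space (e 0) (mu - 1) x /\ e 1 x = 0).
  apply: (infinite_dim_ker s0 (he 1) _ hfin hinf) => x hx.
  by have := weight_e 1 h hx; rewrite subrK.
have [|x [x0 [[wx x1] x2]]] := infinite_dim_neq0 (infinite_dim_ker s1 (he 2) _ hfin' i1).
  move=> x [hx _]; have := weight_e 2 h hx; rewrite -addrA.
  by congr (weight_space _ (_ + _) _); ring.
case/eqP: x0; apply: (highest_weight_eq0 (z := 0) hk h _ wx x1 x2).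
by rewrite addr0.
Qed.

(** By [two_steps_up], a gap at [mu] is also a gap at [- mu] for the mirrored module, so
    [gap_weights] restricts both [mu] and [- mu]. *)
Lemma infinite_dim_succ e g mu : [pchar k] =i pred0 -> simple_vir e g ->
  infinite_dim (weight_space (e 0) (mu - 1)) ->
  infinite_dim (weight_space (e 0) mu).
Proof.
move=> hk h hinf; apply: NNPP => hfin.
have hk0 n : (n.+1%:R == 0 :> k) = false by move/pcharf0P: hk => ->.
have hinf' := two_steps_up hk h hinf hfin.
have h' := mirror_simple_vir h.
have c1 := gap_weights hk h hinf hfin.
have c2 : [\/ - mu = 0, - mu = 1 | 4%:R * - mu + 6%:R = 0].
  apply: (gap_weights hk h'); last by move=> /(infinite_dim_mirror e mu).2.
  by rewrite -opprD; apply/(infinite_dim_mirror e (mu + 1)).1.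
suff mu0 : mu = 0.
  by have := no_gap_at_0 hk h; rewrite -mu0 => /(_ hinf).
(* Each pair of nonzero candidates for [mu] and [- mu] leads to [2 = 0] or [12 = 0] in [k]. *)
have bad n : n.+1%:R = 0 :> k -> mu = 0 by move/eqP; rewrite hk0.
have opp0 : - mu = 0 -> mu = 0 by move/eqP; rewrite oppr_eq0 => /eqP.
case: c1 c2 => [//|m1|m1] [/opp0 //|m2|m2].
- by apply: (bad 1%N); rewrite -[RHS](subrr mu) m2 m1; ring.
- by apply: (bad 1%N); rewrite -m2 m1; ring.
- by apply: (bad 1%N); rewrite -m1 -[mu]opprK m2; ring.
- by apply: (bad 11%N); rewrite -[RHS]addr0 -{1}m1 -m2; ring.
Qed.

Lemma infinite_dim_all e g lam z : [pchar k] =i pred0 -> simple_vir e g ->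
  infinite_dim (weight_space (e 0) lam) ->
  infinite_dim (weight_space (e 0) (lam + z%:~R)).
Proof.
have up (e' : int -> M -> M) g' lam' (n : nat) : [pchar k] =i pred0 ->
    simple_vir e' g' -> infinite_dim (weight_space (e' 0) lam') ->
    infinite_dim (weight_space (e' 0) (lam' + n%:R)).
  move=> hk h hinf; elim: n => [|n IH]; first by rewrite addr0.
  by apply: (infinite_dim_succ hk h); rewrite -addn1 natrD addrA addrK.
move=> hk h hinf; case: z => n; first by rewrite -pmulrn; apply: up h hinf.
apply/(infinite_dim_mirror e _).2; rewrite NegzE rmorphN opprD opprK /= -pmulrn.
by apply: (up _ _ _ _ hk (mirror_simple_vir h)); apply/(infinite_dim_mirror e lam).1.
Qed.

(** Vectors with weight in [lam + Z] span a nonzero submodule, hence [M]; another weight would have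
    an empty list of contributing indices. *)
Lemma weight_support e g lam mu m : simple_vir e g ->
  (exists v, v != 0 /\ weight_space (e 0) lam v) ->
  weight_space (e 0) mu m -> m != 0 -> exists z : int, mu = lam + z%:~R.
Proof.
move=> h [v [v0 wv]] wm /eqP m0; have [he _ _] := h.
apply: NNPP => hz; apply: m0.
pose P (p : int * M) := e 0 p.2 == (lam + p.1%:~R) *: p.2.
(* Taking all such vectors as indices avoids choosing bases of the weight spaces. *)
pose I := {p : int * M | P p}.
pose T (p : I) := (val p).2.
pose w (p : I) := lam + (val p).1%:~R.
have hT p : e 0 (T p) = w p *: T p by apply/eqP; exact: (valP p).
have hv : P (0, v) by rewrite /P addr0; apply/eqP.
pose p0 : I := exist _ (0, v) hv; have sT := in_lin_subspace T.
have stT j p : in_lin T (e j (T p)).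
  have hp : P ((val p).1 + j, e j (T p)).
    by apply/eqP; have := weight_e j h (hT p); rewrite /= intrD addrA.
  by pose q : I := exist _ (_, e j (T p)) hp; apply: (in_lin_mem T q).
have hfull : forall x, in_lin T x.
  apply: (full_of_stable h sT _ (in_lin_mem T p0) v0) => i.
  exact: in_lin_stable.
have [|a ->] := weight_space_in_span (L := [::]) (he 0) hT hfull _ wm.
  by move=> p hp; case: hz; exists (val p).1.
by rewrite big_ord0.
Qed.

(** Schur's argument, with the eigenvector supplied by diagonalizability: an eigenspace of the
    central [c] is a submodule. *)
Lemma scalar_central_charge e c : is_vir_module e c -> is_simple e c ->
  Defs.diagonalizable c -> exists g, simple_vir e g.
Proof.
move=> [he hc hce hb] [[m m0] hs] hd.
have [g [v [v0 hv]]] : exists g v, v != 0 /\ c v = g *: v.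
  have [s [hs1 ms]] := hd m.
  have [/hasP [p ps p0]|/hasPn hn] := boolP (has (fun p : k * M => p.2 != 0) s).
    by exists p.1, p.2; split => //; apply: hs1.
  case/eqP: m0; rewrite ms big_seq big1 // => p /hn.
  by rewrite negbK => /eqP.
have sc := weight_subspace g (hc : lin c).
have cE x : c x = g *: x.
  have sub : is_submodule e c (weight_space c g).
    split; [exact: sc.1|exact: sc.2| |] => [i u|u]; rewrite /weight_space => hu.
      by rewrite hce hu (linZ _ _ (he i)).
    by rewrite hu (linZ _ _ (hc : lin c)) hu.
  case: (hs _ sub) => [h0|]; last exact.
  by case/eqP: v0; apply: h0.
exists g; split => //.
- move=> i j x; have /eqP := hb i j x; rewrite subr_eq addrC => /eqP ->.
  by congr (_ + (_ + _)); case: ifP => // _; rewrite cE scalerA.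
- move=> N sN hN; apply: hs; split => //; [exact: sN.1|exact: sN.2|].
  by move=> u Nu; rewrite cE; apply: subspaceZ.
Qed.

End NoGap.

Theorem theorem1 (k : closedFieldType) (hk : [pchar k] =i pred0)
    (M : lmodType k) (e : int -> M -> M) (c : M -> M)
    (hM : is_vir_module e c) (hW : is_weight_module e c) (hS : is_simple e c)
    (lam : k) (hlam : infinite_dim (weight_space (e 0) lam)) :
  (forall mu : k, in_support e mu <-> exists z : int, mu = lam + z%:~R) /\
  (forall z : int, infinite_dim (weight_space (e 0) (lam + z%:~R))).
Proof.
have [g h] := scalar_central_charge hM hS hW.2.
split=> [mu|z]; last exact: infinite_dim_all hk h hlam.
split=> [[m [m0 wm]]|[z ->]].
  exact: weight_support h (infinite_dim_neq0 hlam) wm m0.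
exact: infinite_dim_neq0 (infinite_dim_all z hk h hlam).
Qed.
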